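(* Let $H\in\mathbb{C}^{M\times M}$ and $\mathbf{z}\in\mathbb{C}^{M}$ be as defined in the context. Then $0$ is a simple eigenvalue of $H$ with a corresponding eigenvector $\mathbf{z}$ if and only if the localization interaction graph $\mathcal{G}'$ has an oriented spanning tree. Further, every nonzero eigenvalue of $H$ has strictly negative real part.
   Context: Setting. There are $N$ agents $\mathcal{V}=\{1,\dots,N\}$ at distinct positions $\mathbf{p}_u\in\mathbb{R}^2$. The bearing vector is $\mathbf{g}_{vu}=(\mathbf{p}_v-\mathbf{p}_u)/\|\mathbf{p}_v-\mathbf{p}_u\|$ and $\angle\mathbf{g}_{vu}\in[-\pi,\pi)$ its angle in a fixed global frame. For distinct agents $u,v,w$, $\alpha^{u}_{wv}\in[-\pi,\pi)$ denotes the counterclockwise angle at $u$ from $\mathbf{g}_{vu}$ to $\mathbf{g}_{wu}$. A set $\mathcal{S}$ of measured subtended angles is given, with $\alpha^{u}_{wv}\in\mathcal{S}$ iff $\alpha^{u}_{vw}\in\mathcal{S}$. Standing assumption: if an agent measures subtended angles between two or more pairs of other agents, all bearing vectors associated with these measurements are related to each other through them (so that the subtended angle at that agent between any two of these agents is determined by its measurements). The communication graph $\mathcal{G}=(\mathcal{V},\mathcal{E})$ has as edges exactly the ordered pairs $(u,v),(v,u),(u,w),(w,u)$ for all $\alpha^{u}_{wv}\in\mathcal{S}$; it is symmetric and assumed connected. Edge localization graph $\bar{\mathcal{G}}=(\bar{\mathcal{V}},\bar{\mathcal{E}})$: for each $(u,v)\in\mathcal{E}$ with no $w$ such that $\alpha^{v}_{wu}\in\mathcal{S}$,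 introduce a new virtual vertex $\bar v^{u}$ (distinct for distinct such pairs), co-located with agent $v$; $\bar{\mathcal{E}}$ is obtained from $\mathcal{E}$ by replacing each such pair $(u,v),(v,u)$ by $(u,\bar v^{u}),(\bar v^{u},u)$; $\bar{\mathcal{V}}$ consists of the agents that measure at least one subtended angle together with all virtual vertices. For $a\in\bar{\mathcal{V}}$ let $\rho(a)$ be the real agent it is (co-located with): $\rho(\bar v^u)=v$, $\rho(v)=v$. The directed line graph $L(\bar{\mathcal{G}})$ has vertex set $\bar{\mathcal{E}}$ and an edge $(e_1,e_2)$ whenever the head of $e_1$ equals the tail of $e_2$. The localization interaction graph $\mathcal{G}'=(\mathcal{V}',\mathcal{E}')$ is $L(\bar{\mathcal{G}})$ with vertices relabelled by a bijection onto $\mathcal{V}'=\{1,\dots,M\}$, $M=|\bar{\mathcal{E}}|$; vertex $k$ corresponding to $(a,b)\in\bar{\mathcal{E}}$ is the edge agent $k$; its neighbor set is $\mathcal{N}_k=\{j:(k,j)\in\mathcal{E}'\}$. For edge agent $k$ corresponding to $(a,b)$ set $\theta_k=\angle\mathbf{g}_{\rho(b)\rho(a)}$ and $z_k=e^{\mathrm{i}\theta_k}$, $\mathbf{z}=[z_1,\dots,z_M]^T$. For $j\in\mathcal{N}_k$ with $j$ corresponding to $(b,c)$, write $u=\rho(a)$, $v=\rho(b)$, $w=\rho(c)$ and set $\theta_{jk}=\mathrm{PV}(\alpha^{v}_{wu}+\pi)$ if $w\neq u$ and $\theta_{jk}=-\pi$ if $w=u$, where $\mathrm{PV}(\theta)=[(\theta+\pi)\bmod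 2\pi]-\pi$. The matrix $H$ has entries $[H]_{kk}=-|\mathcal{N}_k|$, $[H]_{kj}=e^{-\mathrm{i}\theta_{jk}}$ if $j\in\mathcal{N}_k$, and $0$ otherwise. An oriented spanning tree of a directed graph with root $r$ is an acyclic subgraph containing all vertices in which every vertex other than $r$ has a directed path to $r$. *)

(* Defs.v *)
From mathcomp Require Import all_boot all_order all_algebra.
From mathcomp Require Import reals trigo complex.

Set Implicit Arguments.
Unset Strict Implicit.
Unset Printing Implicit Defensive.

Import Order.TTheory GRing.Theory Num.Theory.
Local Open Scope ring_scope.

Section Setting.
Variable R : realType.

(* PV(t) = [(t + pi) mod 2pi] - pi, a value in [-pi, pi). *)
Definition PV (t : R) : R :=
  (t + pi - (2 * pi) * (Num.floor ((t + pi) / (2 * pi)))%:~R) - pi.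

(* The angle in [-pi, pi) of a nonzero vector g of R^2 in the global frame,
   i.e. the unique theta in [-pi, pi) with g = |g| (cos theta, sin theta). *)
Definition vangle (g : R * R) : R :=
  let c := g.1 / Num.sqrt (g.1 ^+ 2 + g.2 ^+ 2) in
  if (0 <= g.2) && (c != -1) then acos c else - acos c.

Variable N : nat.
Variable p : 'I_N -> R * R.

Definition bearing (v u : 'I_N) : R * R :=
  let dx := (p v).1 - (p u).1 in
  let dy := (p v).2 - (p u).2 in
  let d := Num.sqrt (dx ^+ 2 + dy ^+ 2) in
  (dx / d, dy / d).

Definition alpha (u w v : 'I_N) : R :=
  PV (vangle (bearing w u) - vangle (bearing v u)).

(* The set S of measured subtended angles: S u w v <-> alpha^u_{wv} \in S. *)
Variable S : 'I_N -> 'I_N -> 'I_N -> bool.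

(* communication graph: edges (u,v),(v,u),(u,w),(w,u) for alpha^u_{wv} in S *)
Definition Ecomm (x y : 'I_N) : bool :=
  [exists w, S x w y || S x y w] || [exists w, S y w x || S y x w].

Definition nomeas (v u : 'I_N) : bool := ~~ [exists w, S v w u].

(* vertices of the edge localization graph: inl v is the (real) agent v,
   inr (u, v) is the virtual vertex \bar v^u co-located with v. *)
Definition VB := ('I_N + 'I_N * 'I_N)%type.

Definition rho (a : VB) : 'I_N :=
  match a with inl x => x | inr (_, v) => v end.

Definition Ebar (a b : VB) : bool :=
  match a, b with
  | inl x, inl y => [&& Ecomm x y, ~~ nomeas y x & ~~ nomeas x y]
  | inl x, inr (u, v) => [&& x == u, Ecomm u v & nomeas v u]
  | inr (u, v), inl x => [&& x == u, Ecomm u v & nomeas v u]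
  | _, _ => false
  end.

Definition ET := {e : VB * VB | Ebar e.1 e.2}.

Definition Lrel (e1 e2 : ET) : bool := (sval e1).2 == (sval e2).1.

Variable M : nat.
Variable f : 'I_M -> ET.     (* the relabelling bijection, edge agent k <-> f k *)

Definition Eprime (k j : 'I_M) : bool := Lrel (f k) (f j).

Definition expi (t : R) : R[i] := Complex (cos t) (sin t).

Definition theta (k : 'I_M) : R :=
  vangle (bearing (rho (sval (f k)).2) (rho (sval (f k)).1)).

Definition zvec : 'cV[R[i]]_M := \col_k expi (theta k).

Definition theta_jk (j k : 'I_M) : R :=
  let u := rho (sval (f k)).1 in
  let v := rho (sval (f k)).2 in
  let w := rho (sval (f j)).2 in
  if w != u then PV (alpha v w u + pi) else - pi.

Definition Hmat : 'M[R[i]]_M :=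
  \matrix_(k, j)
    if k == j then - (#|[set j' | Eprime k j']|)%:R
    else if Eprime k j then expi (- theta_jk j k) else 0.

End Setting.

Definition has_oriented_spanning_tree (T : finType) (E : rel T) : Prop :=
  exists (r : T) (Tr : rel T),
    [/\ subrel Tr E,
        (forall x y, Tr x y -> ~~ connect Tr y x) &
        (forall x, x != r -> connect Tr x r)].

(* Main.v *)
(* Write z_k = e^{i theta_k} and Z = diag z. Along an edge (k, j) of G' the angles satisfy
   theta_jk = theta_j - theta_k modulo 2 pi, so Z^-1 H Z is the real matrix -L, where L is the
   out-degree Laplacian of G'; in particular H z = 0. Since the rows of -L sum to zero, changing
   basis to (1, e_2, ..., e_M) gives char_poly(-L) = X char_poly(B), so that 0 is simple if and
   only if B is invertible. If every vertex reaches a root, a kernel vector of B gives a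
   nonconstant x with L x constant, against the maximum principle. If there is no root, two
   vertices have disjoint sets of descendants, each of which supports a left null vector of L;
   a combination of these with zero sum is a left null vector of B. The claim on the other
   eigenvalues is Gershgorin's theorem. *)
Require Import Defs.
From mathcomp Require Import all_boot all_order all_algebra.
From mathcomp Require Import reals trigo complex.
From mathcomp Require Import ring lra.
Import Order.TTheory GRing.Theory Num.Theory.
Local Open Scope ring_scope.

(** * Angles as unit complex numbers *)

Section AnglesOnCircle.
Variable R : realType.
Implicit Types (s t : R) (g : R * R).

Lemma expiD s t : expi (s + t) = expi s * expi t.
Proof. by rewrite /expi cosD sinD [RHS]/= [sin s * cos t + _]addrC. Qed.

Lemma expi0 : expi (0 : R) = 1.
Proof. by rewrite /expi cos0 sin0. Qed.

Lemma expiNl t : expi (- t) * expi t = 1.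
Proof. by rewrite -expiD addNr expi0. Qed.

Lemma expi_neq0 t : expi t != 0.
Proof.
by apply/eqP => e0; have := expiNl t; rewrite e0 mulr0 => /esym/eqP; rewrite oner_eq0.
Qed.

Lemma expiN t : expi (- t) = (expi t)^-1.
Proof. by rewrite -[RHS]mul1r -(expiNl t) mulfK ?expi_neq0. Qed.

Lemma norm_expi t : `|expi t| = 1.
Proof. by rewrite normc_def /= cos2Dsin2 sqrtr1. Qed.

Lemma expipi : expi (pi : R) = -1.
Proof. by rewrite /expi cospi sinpi; apply/eqP; rewrite eq_complex /= oppr0 !eqxx. Qed.

Lemma expi2piz (z : int) : expi (2 * pi * z%:~R : R) = 1.
Proof.
have nat_case (n : nat) : expi (2 * pi * n%:R : R) = 1.
  elim: n => [|n IHn]; first by rewrite mulr0 expi0.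
  have -> : 2 * pi * n.+1%:R = 2 * pi * n%:R + (pi + pi) :> R by rewrite -natr1; ring.
  by rewrite expiD IHn expiD expipi mul1r mulrNN mulr1.
case: z => n; first by rewrite -pmulrn nat_case.
by rewrite NegzE rmorphN /= mulrN expiN -pmulrn nat_case invr1.
Qed.

Lemma expi_PV t : expi (PV t) = expi t.
Proof.
rewrite /PV; set z := Num.floor _.
have -> : t + pi - 2 * pi * z%:~R - pi = t + - (2 * pi * z%:~R) by ring.
by rewrite expiD expiN expi2piz invr1 mulr1.
Qed.

Lemma expi_vangle g : g != (0, 0) ->
  expi (vangle g) = Complex (g.1 / Num.sqrt (g.1 ^+ 2 + g.2 ^+ 2))
                            (g.2 / Num.sqrt (g.1 ^+ 2 + g.2 ^+ 2)).
Proof.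
move=> g_neq0; set n2 := g.1 ^+ 2 + g.2 ^+ 2; set d := Num.sqrt n2.
have n2_gt0 : 0 < n2.
  rewrite lt_neqAle addr_ge0 ?sqr_ge0 // andbT eq_sym paddr_eq0 ?sqr_ge0 //.
  by rewrite !sqrf_eq0; apply: contraNN g_neq0; case: g {n2 d} => a b.
have d_gt0 : 0 < d by rewrite sqrtr_gt0.
have d2 : d ^+ 2 = n2 by rewrite sqr_sqrtr // ltW.
set c := g.1 / d.
have c2s2 : 1 - c ^+ 2 = (g.2 / d) ^+ 2.
  by rewrite /c !expr_div_n d2 /n2; field; rewrite -/n2 gt_eqF.
have c_le1 : -1 <= c <= 1.
  rewrite -ler_norml -(@expr_le1 _ 2) ?normr_ge0 // -normrX ger0_norm ?sqr_ge0 //.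
  by rewrite -subr_ge0 c2s2 sqr_ge0.
have sin_c : sin (acos c) = `|g.2 / d| by rewrite sin_acos // c2s2 sqrtr_sqr.
have cos_c : cos (acos c) = c by rewrite acosK.
rewrite /vangle -/n2 -/d -/c /expi; case: ifPn => [/andP[g2 _]|].
  by rewrite cos_c sin_c ger0_norm // divr_ge0 // ltW.
rewrite cosN sinN cos_c sin_c negb_and negbK => /orP[|/eqP c1].
  by rewrite -ltNge => g2; rewrite ltr0_norm ?opprK // pmulr_llt0 ?invr_gt0.
(* The remaining case [c = -1] forces a zero ordinate, so the sign of the angle does not matter. *)
have /eqP : (g.2 / d) ^+ 2 = 0 by rewrite -c2s2 c1; ring.
by rewrite sqrf_eq0 => /eqP ->; rewrite normr0 oppr0.
Qed.

Lemma expi_vangleN g : g != (0, 0) -> expi (vangle (- g.1, - g.2)) = - expi (vangle g).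
Proof.
move=> g_neq0; rewrite !expi_vangle //=.
  by rewrite !sqrrN !mulNr.
by apply: contraNneq g_neq0 => -[/eqP + /eqP]; rewrite !oppr_eq0; case: g => a b /= /eqP-> /eqP->.
Qed.

End AnglesOnCircle.

(** * Bearings between distinct agents *)

Section Bearings.
Variables (R : realType) (N : nat) (p : 'I_N -> R * R).
Hypothesis p_inj : injective p.

Lemma bearing_neq0 u v : u != v -> bearing p u v != (0, 0).
Proof.
move=> uv; rewrite /bearing; set dx := _ - _; set dy := _ - _; set d := Num.sqrt _.
have d_neq0 : d != 0.
  rewrite sqrtr_eq0 -ltNge lt_neqAle addr_ge0 ?sqr_ge0 // andbT eq_sym.
  rewrite paddr_eq0 ?sqr_ge0 // !sqrf_eq0 !subr_eq0.
  apply: contraNN uv => /andP[/eqP e1 /eqP e2]; apply/eqP/p_inj.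
  by case: (p u) (p v) e1 e2 => a b [a' b'] /= -> ->.
apply: contraNneq d_neq0 => -[/eqP + /eqP].
rewrite !mulf_eq0 !invr_eq0 => /orP[/eqP dx0|-> //] /orP[/eqP dy0|-> //].
by rewrite /d dx0 dy0 expr0n addr0 sqrtr0.
Qed.

Lemma expi_bearingC u v : u != v ->
  expi (vangle (bearing p v u)) = - expi (vangle (bearing p u v)).
Proof.
move=> uv; rewrite -expi_vangleN ?bearing_neq0 //; congr (expi (vangle _)).
by rewrite /bearing /= -!mulNr !opprB -(sqrrN (_ - (p v).1)) -(sqrrN (_ - (p v).2)) !opprB.
Qed.

(** The shift by [pi] reverses the bearing of [u] seen from [v], so that the directions of two
    consecutive edges are compared. *)
Lemma expi_alpha u v w : u != v ->
  expi (PV (alpha p v w u + pi)) =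
    expi (vangle (bearing p w v)) / expi (vangle (bearing p v u)).
Proof.
move=> uv; rewrite expi_PV expiD expipi /alpha expi_PV expiD expiN (expi_bearingC v u) 1?eq_sym //.
by rewrite invrN mulrN1 mulrN opprK.
Qed.

End Bearings.

(** * Oriented spanning trees and roots *)

Section SpanningTree.
Variables (T : finType) (E : rel T).

(** Boolean form of reachability in at most [n] steps, from which [ex_minn] extracts the distance to
    [r]. *)
Fixpoint within (r : T) (n : nat) (x : T) : bool :=
  if n is m.+1 then within r m x || [exists y, E x y && within r m y] else x == r.

Lemma within_path r x s : path E x s -> last x s = r -> within r (size s) x.
Proof.
elim: s x => [|y s IHs] x /=; first by move=> _ ->.
move=> /andP[xy ys] ysr; apply/orP; right; apply/existsP; exists y.
by rewrite xy IHs.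
Qed.

(** Only acyclicity is asked of the subgraph, so all edges that decrease the distance to [r] can be
    kept, with no choice of a parent. *)
Lemma oriented_spanning_treeP :
  has_oriented_spanning_tree E <-> exists r, forall x, connect E x r.
Proof.
split=> [[r [Tr [TrE _ Tr_r]]]|[r Er]].
  exists r => x; have [->|xr] := eqVneq x r; first exact: connect0.
  by apply: connect_sub (Tr_r x xr) => a b /TrE; apply: connect1.
have ex_within x : exists n, within r n x.
  by have /connectP[s xs rs] := Er x; exists (size s); apply: within_path.
pose d x := ex_minn (ex_within x).
have d_within x : within r (d x) x by rewrite /d; case: ex_minnP.
have d_min x n : within r n x -> (d x <= n)%N.
  by rewrite /d; case: ex_minnP => m _; apply.
(* The distance to [r] decreases along every edge kept, so no cycle survives. *)
exists r, (fun x y => E x y && (d y < d x)%N); split.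
- by move=> x y /andP[].
- move=> x y /andP[_ dyx]; apply/negP => /connectP[s].
  elim: s y dyx => [|z s IHs] y dyx /=; first by move=> _ exy; rewrite exy ltnn in dyx.
  by case/andP=> /andP[_ dzy]; apply: IHs; apply: ltn_trans dyx.
move=> x _; move: {-1}(d x) (leqnn (d x)) => n; elim: n x => [|n IHn] x dxn.
  have := d_within x; move: dxn; rewrite leqn0 => /eqP-> /= /eqP->; exact: connect0.
have [dx|dx] := leqP (d x) n; first exact: IHn.
have dxE : d x = n.+1 by apply/eqP; rewrite eqn_leq dxn.
have := d_within x; rewrite dxE /= => /orP[/d_min|/existsP[y /andP[xy /d_min dy]]].
  by rewrite dxE ltnn.
apply: connect_trans (IHn y dy); apply: connect1.
by rewrite xy dxE ltnS.
Qed.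

(** The root absorbs the vertices one at a time. In contrapositive form: without a root, some two
    vertices have no common descendant. *)
Lemma common_root (x0 : T) :
  (forall x y, exists z, connect E x z && connect E y z) ->
  exists r, forall x, connect E x r.
Proof.
move=> confl.
have: exists r, forall x, x \in enum T -> connect E x r.
  elim: (enum T) => [|a s [r sr]]; first by exists x0.
  have [z /andP[az rz]] := confl a r; exists z => x.
  rewrite inE => /predU1P[-> //|/sr xr]; exact: connect_trans rz.
by case=> r hr; exists r => x; apply: hr; rewrite mem_enum.
Qed.

End SpanningTree.

(** * Maximum principle on a rooted graph *)

Section MaximumPrinciple.
Variables (F : realFieldType) (T : finType) (E : rel T).
Implicit Types (x : T -> F) (c : F).

(** At a maximum all differences are nonpositive while their sum is not negative, so they vanish;
    the maximal value thus spreads along paths to [r]. *)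
Lemma max_root x c (r : T) : (forall k, connect E k r) ->
  (forall k, \sum_(j | E k j) (x j - x k) = c) -> 0 <= c -> forall k, x k <= x r.
Proof.
move=> Er xc c_ge0 k.
have [m _ x_max] := @Order.TotalTheory.arg_maxP _ F T r predT x isT.
suff xr s a : path E a s -> x a = x m -> x (last a s) = x m.
  have /connectP[s ms ->] := Er m; rewrite (xr s m ms) //; exact: x_max.
elim: s a => [|b s IHs] a //= /andP[ab bs] xa; apply: IHs bs _.
have le0 j : E a j -> 0 <= x a - x j by rewrite subr_ge0 xa => _; apply: x_max.
have: \sum_(j | E a j) (x a - x j) == 0.
  rewrite eq_le sumr_ge0 // andbT.
  have -> : \sum_(j | E a j) (x a - x j) = - c.
    by by rewrite -(xc a) -sumrN; apply: eq_bigr => j _; rewrite opprB.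
  by rewrite oppr_le0.
rewrite psumr_eq0 // => /allP/(_ b); rewrite mem_index_enum ab => /(_ isT) /=.
by rewrite subr_eq0 xa => /eqP.
Qed.

(** Once [c = 0], [max_root] applies to [x] and to [- x], so [r] is both a maximum and a minimum. *)
Lemma harmonic_const x c (r : T) : (forall k, connect E k r) ->
  (forall k, \sum_(j | E k j) (x j - x k) = c) -> forall k, x k = x r.
Proof.
wlog c_ge0 : x c / 0 <= c => [hw Er xc k|Er xc k].
  have [c_ge0|c_lt0] := leP 0 c; first exact: hw xc k.
  apply: oppr_inj; apply: (hw (fun i => - x i) (- c)) => // [|a].
    by rewrite oppr_ge0 ltW.
  by by rewrite -(xc a) -sumrN; apply: eq_bigr => j _; rewrite opprB opprK addrC.
(* At a maximum of [x] the sum is nonpositive, which forces [c = 0]. *)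
have c0 : c = 0.
  have [m _ x_max] := @Order.TotalTheory.arg_maxP _ F T r predT x isT.
  apply/eqP; rewrite eq_le c_ge0 andbT -(xc m) sumr_le0 // => j _.
  by rewrite subr_le0; apply: x_max.
apply/eqP; rewrite eq_le (max_root x c) //=.
rewrite -lerN2; apply: (max_root (fun i => - x i) c) => //.
move=> a; transitivity (- c); last by rewrite c0 oppr0.
by rewrite -(xc a) -sumrN; apply: eq_bigr => j _; rewrite opprB opprK addrC.
Qed.

End MaximumPrinciple.

(** * Characteristic polynomials and the multiplicity of 0 *)

Lemma char_poly_conj (F : fieldType) n (P A B : 'M[F]_n) :
  P \in unitmx -> A *m P = P *m B -> char_poly A = char_poly B.
Proof.
move=> P_unit AP; rewrite /char_poly.
have detP : \det (map_mx polyC P) != 0.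
  by rewrite det_map_mx polyC_eq0 -unitfE -unitmxE.
apply: (mulIf detP); rewrite [RHS]mulrC -!det_mulmx; congr (\det _).
rewrite /char_poly_mx mulmxBl mulmxBr -!map_mxM AP.
by rewrite scalar_mxC.
Qed.

Lemma mup0_mulX (F : fieldType) (q : {poly F}) :
  q != 0 -> mup 0 ('X * q) = 1%N <-> ~~ root q 0.
Proof.
move=> q_neq0; rewrite mupM ?polyX_eq0 //.
have -> : mup (0 : F) 'X = 1%N.
  by have := mup_XsubCX 1 (0 : F) 0; rewrite subr0 expr1 eqxx.
rewrite add1n; split=> [[] m0|/mupNroot -> //].
by rewrite -dvdp_XsubCl XsubC_dvd // m0.
Qed.

(** * Splitting off the all-ones vector *)

Section Deflation.
Variables (F : fieldType) (n : nat) (A : 'M[F]_(1 + n)).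
Hypothesis A1 : A *m const_mx 1 = 0 :> 'cV_(1 + n).

(** Matrix induced by [A] on the quotient by the all-ones line, where [e_1] becomes minus the sum of
    the other basis vectors. *)
Definition deflate : 'M[F]_n := drsubmx A - const_mx 1 *m ursubmx A.

Lemma char_poly_deflate : char_poly A = 'X * char_poly deflate.
Proof.
(* The columns of [P] are the all-ones vector and the remaining basis vectors; [B] is [A] in this
   basis, with zero first column by [A1]. *)
pose P : 'M[F]_(1 + n) := block_mx 1 0 (const_mx 1) 1.
pose B : 'M[F]_(1 + n) := block_mx 0 (ursubmx A) 0 deflate.
have P_unit : P \in unitmx by rewrite unitmxE det_lblock !det1 mulr1 unitr1.
have AP : A *m P = P *m B.
  rewrite -{1}[A]submxK !mulmx_block !mulmx0 !mul0mx !mul1mx !mulmx1 !add0r !addr0.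
  rewrite /deflate [const_mx 1 *m _ + _]addrC subrK.
  have := A1; rewrite -{1}[A]submxK -col_mx_const mul_block_col -col_mx0.
  have -> : const_mx 1 = 1%:M :> 'M[F]_1 by apply/matrixP=> i j; rewrite !mxE !ord1.
  by rewrite !mulmx1 => /eq_col_mx [-> ->].
rewrite (char_poly_conj _ _ _ _ _ P_unit AP) /char_poly /char_poly_mx.
rewrite (scalar_mx_block 1 n) map_block_mx opp_block_mx add_block_mx.
by rewrite !map_mx0 !oppr0 !addr0 det_ublock det_scalar1.
Qed.

Lemma deflate_kernel (y : 'cV[F]_n) : deflate *m y = 0 ->
  exists c, A *m col_mx 0 y = const_mx c.
Proof.
move=> By0; exists ((ursubmx A *m y) 0 0).
have Dy : drsubmx A *m y = const_mx 1 *m (ursubmx A *m y).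
  by apply/eqP; rewrite -subr_eq0 mulmxA -mulmxBl By0.
rewrite -{1}[A]submxK mul_block_col !mulmx0 !add0r -col_mx_const Dy.
congr col_mx; apply/matrixP => i j; rewrite !mxE !ord1 //.
by rewrite big_ord1 !mxE mul1r.
Qed.

(** A row vector that kills the all-ones vector is a functional on the quotient, determined by its
    entries after the first. *)
Lemma deflate_left_kernel (u : 'rV[F]_(1 + n)) : u != 0 ->
  u *m A = 0 -> u *m const_mx 1 = 0 :> 'M_1 -> deflate \notin unitmx.
Proof.
move=> + + u1; have u0E : lsubmx u = - (rsubmx u *m const_mx 1).
  move: u1; rewrite -{1}[u]hsubmxK -col_mx_const mul_row_col.
  have -> : const_mx 1 = 1%:M :> 'M[F]_1 by apply/matrixP=> i j; rewrite !mxE !ord1.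
  by rewrite mulmx1 => /eqP; rewrite addr_eq0 => /eqP.
move=> u_neq0 uA; apply: contraNN u_neq0 => B_unit.
have u'0 : rsubmx u = 0.
  apply: (can_inj (mulmxK B_unit)); rewrite mul0mx /deflate mulmxBr mulmxA.
  move: uA; rewrite -{1}[u]hsubmxK -{1}[A]submxK mul_row_block -row_mx0.
  by move=> /eq_row_mx [_]; rewrite u0E mulNmx addrC.
by rewrite -[u]hsubmxK u0E u'0 mul0mx oppr0 row_mx0.
Qed.

End Deflation.

(** * The graph Laplacian and its left null vectors *)

Section Laplacian.
Variables (n : nat) (E : rel 'I_n).
Hypothesis E_irr : irreflexive E.

(* Sign convention: [A - D], the opposite of the usual Laplacian [L = D - A]. *)
Definition laplacian (F : pzRingType) : 'M[F]_n :=
  \matrix_(i, j) if i == j then - #|[set k | E i k]|%:R else (E i j)%:R.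

Lemma laplacianE (F : pzRingType) (x : 'cV[F]_n) i :
  (laplacian F *m x) i 0 = \sum_(j | E i j) (x j 0 - x i 0).
Proof.
rewrite !mxE sumrB sumr_const -(cardsE (E i)) (bigD1 i) //= !mxE eqxx mulNr mulr_natl addrC.
congr (_ - _); rewrite [RHS]big_mkcond [RHS](bigD1 i) //= E_irr add0r.
apply: eq_bigr => j ji; rewrite mxE eq_sym (negbTE ji).
by case: (E i j); rewrite ?mul1r ?mul0r.
Qed.

Lemma laplacian_const (F : pzRingType) (c : F) : laplacian F *m (const_mx c : 'cV_n) = 0.
Proof.
apply/matrixP=> i j; rewrite ord1 laplacianE [RHS]mxE big1 // => k _.
by rewrite !mxE subrr.
Qed.

(** No edge leaves [C], so the rows in [C] already sum to zero over [C]; that diagonal block is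
    singular, and a left null vector of it extends by zero. *)
Lemma closed_left_kernel (F : fieldType) (C : pred 'I_n) (x0 : 'I_n) :
  C x0 -> (forall i j, C i -> E i j -> C j) ->
  exists2 v : 'rV[F]_n, v != 0 & v *m laplacian F = 0 /\ forall j, ~~ C j -> v 0 j = 0.
Proof.
move=> Cx0 C_closed; set L := laplacian F.
have L0 i j : C i -> ~~ C j -> L i j = 0.
  move=> Ci nCj; rewrite mxE; case: eqVneq => [eij|_]; first by rewrite -eij Ci in nCj.
  by case Eij: (E i j) => //; rewrite (C_closed i j) in nCj.
(* [LC] kills the indicator of [C], and its left null vectors are supported on [C]. *)
pose LC : 'M[F]_n := \matrix_(i, j) if C i then L i j else (i == j)%:R.
pose x : 'cV[F]_n := \col_i (C i)%:R.
have LCx : LC *m x = 0.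
  apply/matrixP => i j; rewrite ord1 [RHS]mxE.
  have [Ci|nCi] := boolP (C i); last first.
    rewrite mxE big1 // => k _; rewrite !mxE (negbTE nCi).
    by case: eqVneq => [<-|_]; rewrite ?(negbTE nCi) ?mulr0 ?mul0r.
  have : (L *m (const_mx 1 : 'cV_n)) i 0 = 0 by rewrite laplacian_const mxE.
  rewrite mxE => <-; rewrite mxE; apply: eq_bigr => k _.
  rewrite [LC i k]mxE Ci [x k 0]mxE [const_mx _ _ _]mxE.
  by have [//|nCk] := boolP (C k); rewrite L0 // !mul0r.
have : \det LC == 0.
  rewrite -det_tr; apply/det0P; exists x^T; last by rewrite -trmx_mul LCx trmx0.
  apply/eqP => /matrixP/(_ 0 x0); rewrite !mxE Cx0 => /eqP; by rewrite oner_eq0.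
case/det0P => v v_neq0 vLC; exists v => //.
have vC j : ~~ C j -> v 0 j = 0.
  move=> nCj; have : (v *m LC) 0 j = 0 by rewrite vLC mxE.
  rewrite mxE => <-; rewrite (bigD1 j) //= mxE (negbTE nCj) eqxx mulr1 big1 ?addr0 // => i ij.
  by rewrite mxE (negbTE ij); case: ifP => [Ci|]; rewrite ?L0 ?mulr0.
split=> //; rewrite -[RHS]vLC; apply/matrixP => a j; rewrite ord1 !mxE.
apply: eq_bigr => i _; rewrite [LC i j]mxE; case: ifPn => // /vC ->.
by rewrite !mul0r.
Qed.

End Laplacian.

Lemma zero_sum_left_kernel (F : fieldType) n (E : rel 'I_n) (a b : 'I_n) :
  irreflexive E -> (forall z, ~~ (connect E a z && connect E b z)) ->
  exists2 u : 'rV[F]_n, u != 0 &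
    u *m laplacian n E F = 0 /\ u *m (const_mx 1 : 'cV_n) = 0.
Proof.
move=> E_irr disj.
have closed x i j : connect E x i -> E i j -> connect E x j.
  by move=> xi ij; apply: connect_trans xi (connect1 ij).
have [v v_neq0 [vL vC]] := closed_left_kernel n E E_irr F (connect E a) a (connect0 E a) (closed a).
have [w w_neq0 [wL wC]] := closed_left_kernel n E E_irr F (connect E b) b (connect0 E b) (closed b).
set one : 'cV[F]_n := const_mx 1.
have [v1|v1] := eqVneq ((v *m one) 0 0) 0.
  by exists v => //; split=> //; apply/matrixP => i j; rewrite !ord1 v1 mxE.
move: v1; set c := (v *m one) 0 0 => c_neq0; set d := (w *m one) 0 0.
(* Weighting each vector by the sum of the other cancels the total. As [c] is nonzero and the
   supports are disjoint, the part in [w] survives. *)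
exists (d *: v - c *: w); last split.
- apply: contraNneq w_neq0 => /matrixP u0; apply/eqP/matrixP => i j.
  rewrite ord1 [RHS]mxE; have [bj|/wC //] := boolP (connect E b j).
  have vj : v 0 j = 0 by apply: vC; have := disj j; rewrite bj andbT.
  have := u0 0 j; rewrite !mxE vj mulr0 sub0r => /eqP.
  by rewrite oppr_eq0 mulf_eq0 (negbTE c_neq0) => /eqP.
- by rewrite mulmxBl -!scalemxAl vL wL !scaler0 subrr.
rewrite mulmxBl -!scalemxAl [v *m one]mx11_scalar [w *m one]mx11_scalar -/c -/d.
by rewrite !scale_scalar_mx mulrC subrr.
Qed.

Lemma deflate_laplacian_unitP (F : realFieldType) n (E : rel 'I_n.+1) : irreflexive E ->
  deflate F n (laplacian n.+1 E F) \in unitmx <-> exists r, forall x, connect E x r.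
Proof.
move=> E_irr; set B := deflate _ _ _; split=> [B_unit|[r Er]].
  apply: (common_root _ _ ord0) => a b; apply/existsP.
  rewrite -[X in is_true X]negbK; apply/negP; rewrite negb_exists => /forallP disj.
  have [u u_neq0 [uL u1]] := zero_sum_left_kernel F _ E a b E_irr disj.
  by have := deflate_left_kernel _ _ _ u u_neq0 uL u1; rewrite -/B B_unit.
rewrite unitmxE unitfE -det_tr; apply/negP => /det0P[v v_neq0 vB].
have [] := deflate_kernel F n (laplacian n.+1 E F) v^T.
  by rewrite -[deflate _ _ _]trmxK -trmx_mul vB trmx0.
move=> c; set x : 'cV[F]_(1 + n) := col_mx 0 v^T => Lx.
have xr : forall k, x k 0 = x r 0.
  apply: (harmonic_const F _ E (fun k => x k 0) c) => // k.
  by rewrite -laplacianE // Lx mxE.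
(* The lift has first coordinate [0], which fixes the constant value of [x]. *)
have x0 : x ord0 0 = 0.
  have -> : ord0 = lshift n (0 : 'I_1) by apply: val_inj.
  by rewrite /x col_mxEu mxE.
case/eqP: v_neq0; apply/matrixP => i j; rewrite ord1 [RHS]mxE.
have := xr (rshift 1 j); rewrite -(xr ord0) x0 /x (col_mxEd (0 : 'cV_1)).
by rewrite mxE.
Qed.

(** * Gershgorin discs and the left half-plane *)

Lemma gershgorin_re_lt0 (R : realType) n (H : 'M[R[i]]_n) (d : 'I_n -> R) (lam : R[i]) :
  (forall k, H k k = - (d k)%:C%C) ->
  (forall k, \sum_(j | j != k) `|H k j| <= (d k)%:C%C) ->
  eigenvalue H lam -> lam != 0 -> complex.Re lam < 0.
Proof.
move=> Hkk Hkj; rewrite eigenvalue_root_char => + lam_neq0.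
(* Rows are dominated, so a column eigenvector is needed. *)
have -> : char_poly H = char_poly H^T.
  rewrite /char_poly -det_tr /char_poly_mx linearB /= tr_scalar_mx.
  by rewrite map_trmx.
rewrite -eigenvalue_root_char => /eigenvalueP[v vH v_neq0].
have Hx k : \sum_j H k j * v 0 j = lam * v 0 k.
  have : (v *m H^T) 0 k = lam * v 0 k by rewrite vH mxE.
  by rewrite mxE => <-; apply: eq_bigr => j _; rewrite mxE mulrC.
have [i0 vi0] : exists i, v 0 i != 0.
  by have /rV0Pn := v_neq0.
(* The order of [R[i]] is only partial, so the largest modulus is chosen through real parts. *)
have [m _ v_max] := @Order.TotalTheory.arg_maxP _ R _ i0 predT
  (fun k => complex.Re `|v 0 k|) isT.
have ReK (z : R[i]) : (complex.Re `|z|)%:C%C = `|z| by rewrite RRe_real ?normr_real.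
have {}v_max j : `|v 0 j| <= `|v 0 m| by rewrite -[`|v 0 j|]ReK -[`|v 0 m|]ReK lecR; apply: v_max.
have vm_gt0 : 0 < `|v 0 m| by apply: lt_le_trans (v_max i0); rewrite normr_gt0.
(* Row [m] of the eigenvector equation puts [lam] in the disc of radius [d m] centred at [- d m]. *)
have lamd : `|lam + (d m)%:C%C| <= (d m)%:C%C.
  rewrite -(ler_pM2r vm_gt0) -normrM.
  have -> : (lam + (d m)%:C%C) * v 0 m = \sum_(j | j != m) H m j * v 0 j.
    by rewrite mulrDl -Hx (bigD1 m) //= Hkk mulNr addrAC addNr add0r.
  apply: le_trans (ler_norm_sum _ _ _) _.
  apply: le_trans (ler_wpM2r (ltW vm_gt0) (Hkj m)); rewrite mulr_suml.
  by apply: ler_sum => j _; rewrite normrM ler_wpM2l.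
move: lam_neq0 lamd; case: lam {vH Hx} => a b.
rewrite normc_def lecR /= eq_complex /= addr0 => ab_neq0 le_d.
have d_ge0 : 0 <= d m by apply: le_trans le_d; apply: sqrtr_ge0.
have : (a + d m) ^+ 2 + b ^+ 2 <= d m ^+ 2.
  by rewrite -(sqr_sqrtr (addr_ge0 (sqr_ge0 (a + d m)) (sqr_ge0 b))) ler_sqr ?nnegrE ?sqrtr_ge0.
have ab_gt0 : 0 < a ^+ 2 + b ^+ 2.
  by rewrite lt_neqAle addr_ge0 ?sqr_ge0 // andbT eq_sym paddr_eq0 ?sqr_ge0 // !sqrf_eq0.
(* This disc meets the closed right half-plane only at [0]: if [a >= 0], expanding [le_d2]
   contradicts [ab_gt0]. *)
move=> le_d2; rewrite ltNge; apply/negP => a_ge0.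
have := mulr_ge0 a_ge0 d_ge0; nra.
Qed.

(** * The matrix of the edge agents *)

Section EdgeAgents.
Variables (R : realType) (N : nat) (p : 'I_N -> R * R).
Variable S : 'I_N -> 'I_N -> 'I_N -> bool.
Hypothesis p_inj : injective p.
Hypothesis S_distinct : forall u w v, S u w v -> [&& u != v, u != w & v != w].

Lemma Ecomm_neq x y : Ecomm S x y -> x != y.
Proof.
rewrite /Ecomm => /orP[] /existsP[w /orP[] /S_distinct /and3P[xy xw yw]] //.
all: by rewrite eq_sym.
Qed.

Lemma Ebar_neq a b : Ebar S a b -> rho a != rho b.
Proof.
case: a b => [x|[u v]] [y|[u' v']] //=; first by case/and3P=> /Ecomm_neq.
  by case/and3P=> /eqP-> /Ecomm_neq.
by case/and3P=> /eqP-> /Ecomm_neq; rewrite eq_sym.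
Qed.

Variables (M : nat) (f : 'I_M -> ET S).
Let z k := expi (theta p f k).

Lemma Eprime_irr : irreflexive (Eprime f).
Proof.
move=> k; apply/negP => /eqP e; have := Ebar_neq _ _ (svalP (f k)).
by rewrite e eqxx.
Qed.

Lemma expi_theta_jk k j : Eprime f k j -> expi (- theta_jk p f j k) = z k / z j.
Proof.
move=> /eqP kj; have kab := Ebar_neq _ _ (svalP (f k)).
rewrite expiN -[RHS]invf_div /theta_jk /z /theta -kj; congr (_^-1).
case: ifPn => [wu|]; first exact: expi_alpha.
(* When [w = u] the second edge runs back along the first, so [z j = - z k], in agreement with the
   angle [- pi]. *)
rewrite negbK => /eqP ->; rewrite expiN expipi invrN1 (expi_bearingC _ _ _ p_inj _ _ _) 1?eq_sym ?kab //.
by rewrite mulNr divff // expi_neq0.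
Qed.

(** The conjugate matrix is real, which gives access to the maximum principle over the ordered field
    [R]. *)
Lemma Hmat_conj : Hmat p f *m diag_mx (\row_k z k) =
  diag_mx (\row_k z k) *m map_mx (real_complex R) (laplacian M (Eprime f) R).
Proof.
rewrite mul_mx_diag mul_diag_mx; apply/matrixP => k j; rewrite !mxE.
case: eqVneq => [<-|kj]; first by rewrite rmorphN rmorph_nat mulrC.
case: ifPn => [Ekj|_]; last by rewrite mul0r rmorph0 mulr0.
by rewrite expi_theta_jk // divfK ?expi_neq0 // rmorph1 mulr1.
Qed.

Lemma Hmat_zvec : Hmat p f *m zvec p f = 0.
Proof.
have -> : zvec p f = diag_mx (\row_k z k) *m map_mx (real_complex R) (const_mx 1 : 'cV_M).
  by rewrite mul_diag_mx; apply/matrixP => k j; rewrite !mxE rmorph1 mulr1.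
by rewrite mulmxA Hmat_conj -mulmxA -map_mxM laplacian_const ?map_mx0 ?mulmx0 //; apply: Eprime_irr.
Qed.

Lemma zvec_neq0 : 'I_M -> zvec p f != 0.
Proof.
move=> k; apply/eqP => /matrixP/(_ k 0)/eqP.
by rewrite !mxE (negbTE (expi_neq0 _ _)).
Qed.

Lemma Hmat_char_poly :
  char_poly (Hmat p f) = map_poly (real_complex R) (char_poly (laplacian M (Eprime f) R)).
Proof.
rewrite map_char_poly; apply: char_poly_conj Hmat_conj.
rewrite unitmxE det_diag unitfE; apply/prodf_neq0 => k _.
by rewrite mxE expi_neq0.
Qed.

Lemma Hmat_mup0P : 'I_M ->
  mup 0 (char_poly (Hmat p f)) = 1%N <-> has_oriented_spanning_tree (Eprime f).
Proof.
move=> k0; apply: (iff_trans _ (iff_sym (oriented_spanning_treeP _ _))); rewrite Hmat_char_poly.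
have irr := Eprime_irr; move: (Eprime f) irr k0; case: M => [|n] E E_irr k0; first by case: k0.
apply: (iff_trans _ (deflate_laplacian_unitP R n E E_irr)).
rewrite (char_poly_deflate _ _ _ (laplacian_const _ _ E_irr _ _)) rmorphM /= map_polyX.
rewrite map_char_poly; apply: (iff_trans (mup0_mulX _ _ _)).
  by rewrite monic_neq0 ?char_poly_monic.
(* Up to sign the constant term is the determinant of the deflated matrix, so [0] is a root exactly
   when that matrix is singular. *)
rewrite /root horner_coef0 char_poly_det mulf_eq0 signr_eq0 /= -unitfE -unitmxE.
by rewrite map_unitmx.
Qed.

(** Off-diagonal entries have modulus one on neighbours and zero elsewhere, so each row sum of
    moduli is the out-degree. *)
Lemma Hmat_re_lt0 lam : eigenvalue (Hmat p f) lam -> lam != 0 -> complex.Re lam < 0.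
Proof.
apply: (gershgorin_re_lt0 _ _ _ (fun k => #|[set j | Eprime f k j]|%:R)) => k.
  by rewrite mxE eqxx rmorph_nat.
rewrite rmorph_nat -sum1_card natr_sum big_mkcond [leRHS]big_mkcond.
apply: ler_sum => j _; rewrite inE mxE [k == j]eq_sym; case: ifPn => [jk|_].
  by rewrite (negbTE jk); case: ifP => _; rewrite ?norm_expi ?normr0.
by case: ifP.
Qed.

End EdgeAgents.

Theorem theorem2 (R : realType) (N : nat) (p : 'I_N -> R * R)
  (S : 'I_N -> 'I_N -> 'I_N -> bool)
  (p_inj : injective p)
  (S_distinct : forall u w v, S u w v -> [&& u != v, u != w & v != w])
  (S_sym : forall u w v, S u w v = S u v w)
  (S_standing : forall u v v', [exists w, S u w v] -> [exists w, S u w v'] ->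
                   connect (S u) v v')
  (G_conn : forall x y, connect (Ecomm S) x y)
  (M : nat) (f : 'I_M -> ET S) (f_bij : bijective f) :
  ((mup 0 (char_poly (Hmat p f)) = 1%N /\
    Hmat p f *m zvec p f = 0 /\ zvec p f != 0)
   <-> has_oriented_spanning_tree (Eprime f))
  /\ (forall lam : R[i], eigenvalue (Hmat p f) lam -> lam != 0 ->
        complex.Re lam < 0).
Proof.
split; last exact: Hmat_re_lt0.
split=> [[mup1 [_ z_neq0]]|tree].
  (* A nonzero entry shows that [M] is positive; in the other direction the root of the tree
     does. *)
  have /cV0Pn[k _] := z_neq0.
  by apply/(Hmat_mup0P _ _ _ _ p_inj S_distinct _ _ k).
have [r _] := tree; split; first exact/(Hmat_mup0P _ _ _ _ p_inj S_distinct _ _ r).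
by split; [exact: Hmat_zvec|exact: zvec_neq0].
Qed.
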